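(* Let $H$ be a real separable Hilbert space, let $K \subset H$ be a compact subset, and let $F$ be a continuously differentiable real-valued functional on $K$. Then for every orthonormal basis $\{\phi_0,\phi_1,\ldots\}$ of $H$, every $\epsilon > 0$ and every $\theta \in K$, there exists $M \in \mathbb{N}$ such that for all $m \geq M$, $$\left\| \frac{\delta F([\theta])}{\delta \theta} - P_m \frac{\delta F([P_m\theta])}{\delta \theta} \right\|_H < \epsilon ,$$ where $P_m$ is the orthogonal projection of $H$ onto $\mathrm{span}\{\phi_0,\ldots,\phi_{m-1}\}$.
   Context: $(\cdot,\cdot)_H$ and $\|\cdot\|_H$ denote the inner product and norm of $H$. Orthonormal bases are indexed by $k = 0,1,2,\ldots$, and $P_m\theta = \sum_{k=0}^{m-1} (\theta,\phi_k)_H\,\phi_k$. A functional is a map $F: D(F) \to \mathbb{R}$ with $D(F) \subset H$ open. ''$F$ is continuously differentiable on $K$'' means that $K \subset D(F)$, that $F$ is Fréchet differentiable on $D(F)$, and that the derivative $\theta \mapsto F'([\theta])$ is continuous into the bounded linear functionals on $H$ with the operator norm. The functional derivative $\frac{\delta F([\theta])}{\delta\theta} \in H$ is the Riesz representative of the Fréchet derivative at $\theta$, i.e. the unique element of $H$ with $F'([\theta])\eta = \left(\frac{\delta F([\theta])}{\delta\theta},\eta\right)_H$ for all $\eta \in H$. The symbol $\frac{\delta F([P_m\theta])}{\delta\theta}$ denotes the functional derivative of $F$ evaluated at the point $P_m\theta$. The inequality in the claim for $m \ge M$ is understood to include that $P_m\theta \in D(F)$, so that this element is defined. *)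

(* Defs.v *)
From HB Require Import structures.
From mathcomp Require Import all_boot all_order all_algebra.
From mathcomp Require Import sesquilinear.
From mathcomp Require Import all_classical all_reals all_analysis.

Set Implicit Arguments.
Unset Strict Implicit.
Unset Printing Implicit Defensive.

Import Order.TTheory GRing.Theory Num.Theory.
Import numFieldNormedType.Exports.

Local Open Scope classical_set_scope.
Local Open Scope ring_scope.

Definition separable (T : topologicalType) : Prop :=
  exists2 S : set T, countable S & dense S.

Section HilbertSpace.
Context {R : realType} {H : completeNormedModType R}.

(* A real Hilbert space is a complete normed space H together with an inner
   product (a positive definite symmetric bilinear form) inducing its norm. *)
Definition induces_norm (dot : {dot H for idfun}) : Prop :=
  forall x : H, `|x| ^+ 2 = dot x x.

Definition fin_lin_span (phi : nat -> H) : set H :=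
  [set x | exists n (c : nat -> R), x = \sum_(k < n) c k *: phi k].

(* Orthonormal bases are sequences indexed by all of nat, so a space that has
   one is infinite-dimensional. *)
Definition orthonormal_basis (dot : {dot H for idfun}) (phi : nat -> H) : Prop :=
  (forall i j, dot (phi i) (phi j) = (i == j)%:R) /\ dense (fin_lin_span phi).

Definition orth_proj (dot : {dot H for idfun}) (phi : nat -> H) (m : nat)
  (x : H) : H := \sum_(k < m) dot x (phi k) *: phi k.

(* The operator norm; a real supremum, hence meaningful for bounded l only. *)
Definition opnorm (l : H -> R) : R :=
  sup [set `|l x| | x in [set x : H | `|x| <= 1]].

(* A functional with domain the open set D is represented by a total function
   F : H -> R whose values outside D are irrelevant: D being open, 'd F x and
   the limit below depend only on F near points of D. *)
Definition continuously_differentiable_on (K D : set H) (F : H -> R) : Prop :=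
  [/\ K `<=` D,
      forall x, D x -> differentiable F x &
      forall x, D x -> opnorm ('d F y \- 'd F x) @[y --> x] --> (0 : R)].

(* The Riesz representative of 'd F x, chosen by classical epsilon; it exists
   and is unique whenever F is differentiable at x. *)
Definition functional_derivative (dot : {dot H for idfun}) (F : H -> R)
  (x : H) : H := xget 0 [set g : H | forall h : H, 'd F x h = dot g h].

End HilbertSpace.

(* Main.v *)
Require Import Defs.
From mathcomp Require Import all_boot all_order all_algebra.
From mathcomp Require Import sesquilinear.
From mathcomp Require Import all_classical all_reals all_analysis.
From mathcomp Require Import ring lra.
Import Order.TTheory GRing.Theory Num.Theory.
Import numFieldNormedType.Exports.
Local Open Scope classical_set_scope.
Local Open Scope ring_scope.

(** Write [g] for the functional derivative and [P] for the projections. Then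
    [g theta - P m (g (P m theta))] is the sum of [g theta - P m (g theta)] and
    [P m (g theta - g (P m theta))]. The first term tends to 0 because
    [P m x --> x] for every [x] (lemma [orth_proj_cvg]). The second has norm at
    most that of [g theta - g (P m theta)], since projections are contractions
    (lemma [norm_orth_proj_le]), and this tends to 0 because [P m theta] tends
    to [theta] and [g] is continuous (lemma [cvg_functional_derivative]):
    a difference of gradients has norm at most the operator norm of the
    difference of the Fréchet derivatives.

    That last comparison needs the gradient to represent the derivative, i.e.
    the Riesz representation theorem. With an orthonormal basis at hand it
    follows from completeness by taking the representative of [l] to be the sum
    of the [l (phi k) *: phi k] (lemmas [riesz_fischer] and
    [riesz_representation]). *)

Section InnerProduct.
Context {R : realType} {H : completeNormedModType R} {dot : {dot H for idfun}}.
Hypothesis dot_norm : induces_norm dot.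

Lemma dotC (x y : H) : dot x y = dot y x.
Proof. by have := hermC dot x y; rewrite /= expr0 mul1r. Qed.

Lemma dotBl (x y z : H) : dot (x - y) z = dot x z - dot y z.
Proof. exact: (linearBl dot). Qed.

Lemma dotZl a (x y : H) : dot (a *: x) y = a * dot x y.
Proof. exact: (linearZl_LR dot). Qed.

Lemma dotBr (x y z : H) : dot x (y - z) = dot x y - dot x z.
Proof. exact: (linearBr dot). Qed.

Lemma dotZr a (x y : H) : dot x (a *: y) = a * dot x y.
Proof. exact: (linearZr_LR dot). Qed.

Lemma dot0l (x : H) : dot 0 x = 0.
Proof. exact: (linear0l dot). Qed.

Lemma dot_suml I (r : seq I) (P : pred I) (f : I -> H) (y : H) :
  dot (\sum_(i <- r | P i) f i) y = \sum_(i <- r | P i) dot (f i) y.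
Proof. exact: (linear_sumlz dot). Qed.

(** The square of the norm of [a *: x - b *: y] is nonnegative; the choices
    [a = |y|] and [b = |x|] or [b = - |x|] give the two bounds on [dot x y],
    up to the factor [|x| * |y|]. *)
Lemma cauchy_schwarz (x y : H) : `|dot x y| <= `|x| * `|y|.
Proof.
have quad_ge0 (a b : R) :
    0 <= a ^+ 2 * `|x| ^+ 2 - 2 * (a * b * dot x y) + b ^+ 2 * `|y| ^+ 2.
  have := sqr_ge0 `|a *: x - b *: y|.
  rewrite !dot_norm dotBl !dotBr !dotZl !dotZr (dotC y x).
  by congr (_ <= _); ring.
have [->|x0] := eqVneq x 0; first by rewrite dot0l !normr0 mul0r.
have [->|y0] := eqVneq y 0; first by rewrite dotC dot0l !normr0 mulr0.
have xy_gt0 : 0 < `|x| * `|y| by rewrite mulr_gt0 ?normr_gt0.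
have plus := quad_ge0 `|y| `|x|; have minus := quad_ge0 `|y| (- `|x|).
rewrite ler_norml; apply/andP; split; rewrite -(ler_pM2l xy_gt0).
  by move: `|x| `|y| (dot x y) plus minus => a b d plus minus; lra.
by move: `|x| `|y| (dot x y) plus minus => a b d plus minus; lra.
Qed.

Lemma cvg_dotl {T : Type} {f : set_system T} {Ff : Filter f} (u : T -> H)
  (x y : H) : u @ f --> x -> dot (u t) y @[t --> f] --> dot x y.
Proof.
move=> ux; apply/cvgrPdist_le => e e0.
have d0 : 0 < e / (`|y| + 1) by rewrite divr_gt0// ltr_wpDl.
near=> t; rewrite -dotBl (le_trans (cauchy_schwarz _ _))//.
have : `|x - u t| <= e / (`|y| + 1) by near: t; exact: cvgr_dist_le.
rewrite ler_pdivlMr ?ltr_wpDl//; apply: le_trans.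
by rewrite ler_wpM2l// lerDl.
Unshelve. all: by end_near. Qed.

(** The lower bound comes from testing at the unit vector along [g].
    Boundedness of the set of values is what makes [opnorm], a supremum in the
    reals, dominate that test. *)
Lemma norm_le_opnorm (l : H -> R) (g : H) :
  (forall h, l h = dot g h) -> `|g| <= opnorm l.
Proof.
move=> lE; set S := [set `|l x| | x in [set x : H | `|x| <= 1]].
have S_ub : has_ubound S.
  exists `|g| => _ [x /= x1 <-]; rewrite lE.
  by rewrite (le_trans (cauchy_schwarz _ _))// ler_piMr.
apply: (ub_le_sup S_ub); have [->|g0] := eqVneq g 0.
  by exists 0; rewrite /= ?lE ?normr0// dotC dot0l normr0.
have g_neq0 : `|g| != 0 by rewrite normr_eq0.
exists (`|g|^-1 *: g) => /=; first by rewrite normrZ normfV normr_id mulVf.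
by rewrite lE dotZr -dot_norm expr2 mulKf// normr_id.
Qed.

Context {phi : nat -> H}.
Hypothesis phi_orth : forall i j, dot (phi i) (phi j) = (i == j)%:R.
Local Notation P := (orth_proj dot phi).

Lemma dot_comb (r : seq nat) (c : nat -> R) j : uniq r ->
  dot (\sum_(k <- r) c k *: phi k) (phi j) = if j \in r then c j else 0.
Proof.
move=> r_uniq; rewrite dot_suml.
have [jr|jNr] := boolP (j \in r).
  rewrite (bigD1_seq j)//= dotZl phi_orth eqxx mulr1 big1 ?addr0// => k /negbTE kj.
  by rewrite dotZl phi_orth kj mulr0.
rewrite big_seq big1// => k kr; rewrite dotZl phi_orth.
by case: eqVneq kr jNr => [->->|]//; rewrite mulr0.
Qed.

Lemma norm_comb (r : seq nat) (c : nat -> R) : uniq r ->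
  `|\sum_(k <- r) c k *: phi k| ^+ 2 = \sum_(k <- r) c k ^+ 2.
Proof.
move=> r_uniq; rewrite dot_norm {1}dot_suml big_seq [RHS]big_seq.
by apply: eq_bigr => k kr; rewrite dotZl dotC dot_comb// kr expr2.
Qed.

Lemma orth_projE m x : P m x = \sum_(0 <= k < m) dot x (phi k) *: phi k.
Proof. by rewrite big_mkord. Qed.

Lemma orth_projB m x y : P m (x - y) = P m x - P m y.
Proof.
rewrite /orth_proj -sumrB; apply: eq_bigr => k _.
by rewrite dotBl scalerBl.
Qed.

Lemma dot_orth_proj m x : dot x (P m x) = `|P m x| ^+ 2.
Proof.
rewrite orth_projE norm_comb ?iota_uniq// dotC dot_suml.
by under eq_bigr do rewrite dotZl (dotC (phi _)) -expr2.
Qed.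

(** By [dot_orth_proj] and Cauchy-Schwarz, [|P m x| ^+ 2 <= |x| * |P m x|]. *)
Lemma norm_orth_proj_le m x : `|P m x| <= `|x|.
Proof.
have [->|Px0] := eqVneq (P m x) 0; first by rewrite normr0.
have Px_gt0 : 0 < `|P m x| by rewrite normr_gt0.
rewrite -(ler_pM2r Px_gt0) -expr2 -dot_orth_proj.
exact: le_trans (ler_norm _) (cauchy_schwarz _ _).
Qed.

Lemma orth_proj_comb m n (c : nat -> R) : (n <= m)%N ->
  P m (\sum_(k < n) c k *: phi k) = \sum_(k < n) c k *: phi k.
Proof.
move=> nm; rewrite orth_projE -(big_mkord xpredT (fun k => c k *: phi k)).
rewrite (big_cat_nat (n := n))//= -[RHS]addr0; congr (_ + _).
  apply: eq_big_nat => k kn.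
  by rewrite dot_comb ?iota_uniq// mem_index_iota kn.
rewrite big_nat big1// => k /andP[nk _].
by rewrite dot_comb ?iota_uniq// mem_index_iota ltnNge nk scale0r.
Qed.

(** The coefficients are square-summable, so the squared norms of the blocks of
    the series, which [norm_comb] turns into blocks of a convergent real
    series, satisfy the Cauchy criterion. *)
Lemma riesz_fischer (c : nat -> R) (C : R) :
  (forall n, \sum_(0 <= k < n) c k ^+ 2 <= C) ->
  cvgn (series (fun k => c k *: phi k)).
Proof.
move=> c2_le.
have /cauchy_cvgP/cauchy_seriesP c2_cauchy : cvgn (series (fun k => c k ^+ 2)).
  apply: nondecreasing_is_cvgn; last by exists C => _ [n _ <-]; exact: c2_le.
  by apply: nondecreasing_series => k _ _; exact: sqr_ge0.
apply/cauchy_cvgP/cauchy_seriesP => e e0.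
have /c2_cauchy : 0 < e ^+ 2 by rewrite exprn_gt0.
apply: filterS => mn; rewrite ger0_norm ?sumr_ge0//; last first.
  by move=> k _; exact: sqr_ge0.
by rewrite -norm_comb ?iota_uniq// ltr_pXn2r ?nnegrE// ltW.
Qed.

Hypothesis phi_dense : dense (fin_lin_span phi).

(** A finite combination [y] of basis vectors close to [x] is fixed by [P m] for
    [m] large, and then [x - P m x] is [(x - y) - P m (x - y)], in which both
    terms are small. *)
Lemma orth_proj_cvg x : P m x @[m --> \oo] --> x.
Proof.
apply/cvgrPdist_lt => e e0; have e2 : 0 < e / 2 by rewrite divr_gt0.
have [||y []] := phi_dense (ball x (e / 2)).
- by exists x; exact: ballxx.
- exact: ball_open.
rewrite -ball_normE /= => xy [n [c yE]].
exists n => // m /= nm; rewrite [e]splitr.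
have Py : P m y = y by rewrite yE orth_proj_comb.
have -> : x - P m x = (x - y) - P m (x - y).
  by rewrite orth_projB Py opprB addrA subrK.
rewrite (le_lt_trans (ler_normB _ _))// ltrD//.
exact: le_lt_trans (norm_orth_proj_le _ _) xy.
Qed.

(** The partial sums [s n] of the candidate representative satisfy
    [l (s n) = |s n| ^+ 2], so a bound for [l] also bounds their norms; this
    gives convergence. The limit and [l] agree on each [phi k], hence on each
    projection [P m h], hence at [h] by continuity. *)
Lemma riesz_representation (l : {linear H -> R}) : continuous l ->
  exists g : H, forall h, l h = dot g h.
Proof.
move=> l_cont; pose s := series (fun k => l (phi k) *: phi k).
have /linear_bounded_continuous/linear_boundedP/pinfty_ex_gt0[C C0 l_le] := l_cont.
have sE n : l (s n) = `|s n| ^+ 2.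
  rewrite /s/= norm_comb ?iota_uniq// linear_sum.
  by apply: eq_bigr => k _; rewrite linearZ expr2.
have s_le n : `|s n| <= C.
  have [->|sn0] := eqVneq (s n) 0; first by rewrite normr0 ltW.
  have sn_gt0 : 0 < `|s n| by rewrite normr_gt0.
  rewrite -(ler_pM2r sn_gt0) -expr2 -sE.
  exact: le_trans (ler_norm _) (l_le _).
have /cvg_ex[g sg] : cvgn s.
  apply: (@riesz_fischer _ (C ^+ 2)) => n.
  rewrite -norm_comb ?iota_uniq//; apply: lerXn2r (s_le n); rewrite nnegrE//.
  exact: ltW.
exists g => h.
have g_phi k : dot g (phi k) = l (phi k).
  have : dot (s n) (phi k) @[n --> \oo] --> dot g (phi k) by exact: cvg_dotl.
  move=> /norm_cvg_unique; apply.
  (* The term [phi k] enters the partial sums from index [k.+1] on. *)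
  apply: cvg_near_cst; exists k.+1 => // n /= kn.
  by rewrite dot_comb ?iota_uniq// mem_index_iota kn.
have gP m : dot (P m h) g = l (P m h).
  rewrite dot_suml linear_sum; apply: eq_bigr => k _.
  by rewrite linearZ dotZl (dotC _ g) g_phi.
have hP := orth_proj_cvg h.
have : dot (P m h) g @[m --> \oo] --> dot h g by exact: cvg_dotl.
rewrite (funext gP) (dotC h) => dotPh.
have lPh : l (P m h) @[m --> \oo] --> l h.
  by apply: continuous_cvg hP; exact: l_cont.
exact: norm_cvg_unique lPh dotPh.
Qed.

Lemma functional_derivativeP (F : H -> R) x : differentiable F x ->
  forall h, 'd F x h = dot (functional_derivative dot F x) h.
Proof.
move=> dF; have [g gP] := riesz_representation _ (diff_continuous dF).
by rewrite /functional_derivative; case: xgetP => [g' _ //|/(_ g)[]].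
Qed.

Lemma cvg_functional_derivative (F : H -> R) (D : set H) x :
  open D -> D x -> (forall y, D y -> differentiable F y) ->
  opnorm ('d F y \- 'd F x) @[y --> x] --> (0 : R) ->
  functional_derivative dot F y @[y --> x] --> functional_derivative dot F x.
Proof.
move=> openD Dx diffF /cvgrPdist_lt dF_cont; apply/cvgrPdist_lt => e e0.
near=> y.
have Dy : D y by near: y; exact: open_nbhs_nbhs.
rewrite distrC; apply: (@le_lt_trans _ _ (opnorm ('d F y \- 'd F x))).
  apply: norm_le_opnorm => h /=.
  by rewrite dotBl -!functional_derivativeP//; exact: diffF.
rewrite (le_lt_trans (ler_norm _))// -[X in `|X|]opprK normrN -sub0r.
by near: y; exact: dF_cont.
Unshelve. all: by end_near. Qed.

End InnerProduct.

Theorem theoremD1 (R : realType) (H : completeNormedModType R)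
    (dot : {dot H for idfun}) (dot_norm : induces_norm dot)
    (sepH : separable H)
    (K : set H) (compactK : compact K)
    (D : set H) (openD : open D) (F : H -> R)
    (C1F : continuously_differentiable_on K D F)
    (phi : nat -> H) (basis_phi : orthonormal_basis dot phi)
    (eps : R) (eps_gt0 : 0 < eps) (theta : H) (Ktheta : K theta) :
  exists M : nat, forall m : nat, (M <= m)%N ->
    D (orth_proj dot phi m theta) /\
    `| functional_derivative dot F theta
       - orth_proj dot phi m
           (functional_derivative dot F (orth_proj dot phi m theta)) | < eps.
Proof.
have [phi_orth phi_dense] := basis_phi.
have [KD diffF dF_cont] := C1F; have Dtheta := KD _ Ktheta.
pose g := functional_derivative dot F.
pose P := orth_proj dot phi.
have P_cvg x : P m x @[m --> \oo] --> x by exact: orth_proj_cvg.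
have gP_cvg : g (P m theta) @[m --> \oo] --> g theta.
  apply: (cvg_comp _ _ (P_cvg theta)).
  by apply: (cvg_functional_derivative dot_norm phi_orth phi_dense _ D) => //;
    exact: dF_cont.
have eps2_gt0 : 0 < eps / 2 by rewrite divr_gt0.
have /cvgrPdist_lt/(_ _ eps2_gt0) P_near := P_cvg (g theta).
have /cvgrPdist_lt/(_ _ eps2_gt0) gP_near := gP_cvg.
suff [M _ MP] : \forall m \near \oo, D (P m theta) /\
    `|g theta - P m (g (P m theta))| < eps.
  by exists M => m /MP.
near=> m; split; first by near: m; exact/(P_cvg theta)/open_nbhs_nbhs.
rewrite -(subrK (P m (g theta)) (g theta)) -addrA -orth_projB [eps]splitr.
rewrite (le_lt_trans (ler_normD _ _))// ltrD//.
  by near: m; exact: P_near.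
rewrite (le_lt_trans (norm_orth_proj_le dot_norm phi_orth _ _))//.
by near: m; exact: gP_near.
Unshelve. all: by end_near. Qed.
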